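(* Let $A$ be a self-adjoint nonnegative linear operator with dense domain on a separable real Hilbert space $H$. Let $c:[0,+\infty)\to\mathbb{R}$ satisfy $0<\mu_1\le c(t)\le\mu_2$ for every $t\ge0$, and $$|c(a)-c(b)|\le\omega(|a-b|)\qquad\forall a\ge0,\ \forall b\ge0,$$ for some continuity modulus $\omega$. Let $\sigma\in(0,1/2]$ and $\delta>0$ be real numbers such that $$4\delta^{2}\mu_1>\Lambda_\infty^{2}+2\delta\Lambda_\infty,\qquad\text{where}\qquad\Lambda_\infty:=\limsup_{\varepsilon\to0^{+}}\frac{\omega(\varepsilon)}{\varepsilon^{1-2\sigma}}.$$ Let $(u_0,u_1)\in D(A^{1/2})\times H$, and let $u$ be the unique solution of the problem $$u''(t)+2\delta A^{\sigma}u'(t)+c(t)Au(t)=0,\qquad u(0)=u_0,\quad u'(0)=u_1.$$ Set $\varphi(x):=x^{2\sigma}$. Then there exists $r>0$ such that $$u\in C^{0}\left((0,+\infty),\mathcal{G}_{\varphi,rt,1/2}(A)\right)\cap C^{1}\left((0,+\infty),\mathcal{G}_{\varphi,rt,0}(A)\right),$$ and there exist $\nu\ge1$ and $K>0$ such that, for every $t>0$, $$\|u_{\nu,+}'(t)\|_{\varphi,rt,0}^{2}+\|u_{\nu,+}(t)\|_{\varphi,rt,1/2}^{2}\le K\left(|u_{1,\nu,+}|^{2}+|A^{1/2}u_{0,\nu,+}|^{2}\right).$$ The constants $r$, $\nu$, and $K$ depend only on $\delta$, $\mu_1$, $\mu_2$, $\sigma$ and $\omega$.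
   Context: Continuity modulus: a continuous function $\omega:[0,+\infty)\to[0,+\infty)$ such that $\omega(0)=0$, $\omega(x)>0$ for every $x>0$, $x\mapsto\omega(x)$ is nondecreasing, and $x\mapsto x/\omega(x)$ is nondecreasing (on $x>0$). Spectral representation. By the spectral theorem, $H$ is identified with $L^2(M,\mu)$ for a suitable measure space $(M,\mu)$, in such a way that $A$ becomes multiplication by $\lambda^2(\xi)$, where $\lambda:M\to[0,+\infty)$ is measurable. The element of $L^2(M,\mu)$ corresponding to $u$ is denoted by $\widehat u(\xi)$. (If $H$ has an orthonormal basis $\{e_k\}$ with $Ae_k=\lambda_k^2e_k$, then $M=\mathbb{N}$ with counting measure, $\lambda(k)=\lambda_k$, and $\widehat u(k)=u_k=\langle u,e_k\rangle$.) Spaces. For $\alpha\ge0$, $u\in D(A^{\alpha})$ means $\int_M(1+\lambda(\xi))^{4\alpha}|\widehat u(\xi)|^2\,d\mu<+\infty$; $|\cdot|$ is the norm of $H$. For a function $\varphi\ge0$, $r\ge0$, $\alpha\in\mathbb{R}$, the generalized Gevrey space $\mathcal{G}_{\varphi,r,\alpha}(A)$ is the set of $u$ with $$\|u\|_{\varphi,r,\alpha}^2:=\int_M(1+\lambda(\xi))^{4\alpha}|\widehat u(\xi)|^2\exp\left(2r\varphi(\lambda(\xi))\right)d\mu<+\infty.$$ These spaces shrink as $r$ increases. The statement $u\in C^0((0,+\infty),\mathcal{G}_{\varphi,rt,1/2}(A))\cap C^1((0,+\infty),\mathcal{G}_{\varphi,rt,0}(A))$ means that for every $\tau>0$ one has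 $u\in C^0([\tau,+\infty),\mathcal{G}_{\varphi,r\tau,1/2}(A))\cap C^1([\tau,+\infty),\mathcal{G}_{\varphi,r\tau,0}(A))$. Frequency decomposition. For $\nu\ge0$ and a vector $u$, $u_{\nu,+}$ is the vector with $\widehat{u_{\nu,+}}=\widehat u$ on $\{\lambda\ge\nu\}$ and $0$ elsewhere. We write $u_{\nu,+}(t)$, $u_{\nu,+}'(t)$, $u_{0,\nu,+}$, $u_{1,\nu,+}$ for the corresponding components of $u(t)$, $u'(t)$, $u_0$, $u_1$. Solution. The unique solution $u$ is characterized componentwise: for a.e. $\xi\in M$, with $\lambda=\lambda(\xi)$, the function $t\mapsto\widehat{u(t)}(\xi)=:y(t)$ solves $y''+2\delta\lambda^{2\sigma}y'+\lambda^2c(t)y=0$ on $[0,+\infty)$ with $y(0)=\widehat{u_0}(\xi)$, $y'(0)=\widehat{u_1}(\xi)$; moreover $\widehat{u'(t)}(\xi)=y'(t)$. (It is known that this is the unique solution, a priori with values in a large space of ultradistributions.) *)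

(* Defs.v *)
From HB Require Import structures.
From mathcomp Require Import all_boot all_order all_algebra.
From mathcomp Require Import all_classical all_reals all_analysis.

Set Implicit Arguments.
Unset Strict Implicit.
Unset Printing Implicit Defensive.
Import Order.TTheory GRing.Theory Num.Theory.
Import numFieldNormedType.Exports.

Local Open Scope classical_set_scope.
Local Open Scope ring_scope.

(* omega : [0, +oo) -> [0, +oo) is given as a total function on R whose values
   at negative arguments are irrelevant. *)
Record continuity_modulus (R : realType) (omega : R -> R) : Prop := {
  modulus_continuous : {within `[0, +oo[, continuous omega};
  modulus0 : omega 0 = 0;
  modulus_gt0 : forall x, 0 < x -> 0 < omega x;
  modulus_nondecreasing : forall x y, 0 <= x -> x <= y -> omega x <= omega y;
  modulus_ratio_nondecreasing :
    forall x y, 0 < x -> x <= y -> x / omega x <= y / omega y }.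

(* A real Hilbert space is a complete normed module whose norm is induced by
   a (symmetric, positive definite, bilinear) form dot. *)
Definition hilbert_norm (R : realType) (H : completeNormedModType R)
    (dot : {dot H for idfun}) : Prop :=
  forall x : H, `|x| ^+ 2 = dot x x.

Definition separable (T : topologicalType) : Prop :=
  exists2 S : set T, countable S & dense S.

(* An unbounded operator is a pair of a domain dom and a function A whose
   values outside dom are irrelevant.  Condition [sa_adjoint] says that the
   graph of A equals the graph of its adjoint: v is in the domain of the
   adjoint, with value w, iff <A x, v> = <x, w> for all x in dom. *)
Record selfadjoint_nonneg (R : realType) (H : completeNormedModType R)
    (dot : {dot H for idfun}) (dom : set H) (A : H -> H) : Prop := {
  sa_dom0 : dom 0;
  sa_linear : forall (a : R) x y, dom x -> dom y ->
    dom (a *: x + y) /\ A (a *: x + y) = a *: A x + A y;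
  sa_dense : dense dom;
  sa_adjoint : forall v w : H,
    (dom v /\ A v = w) <-> (forall x, dom x -> dot (A x) v = dot x w);
  sa_nonneg : forall x, dom x -> 0 <= dot (A x) x }.

(* hat is a unitary map from H onto L^2(M, mu) that turns A into the
   multiplication by lambda^2, with its maximal domain. *)
Record spectral_representation (R : realType) (H : completeNormedModType R)
    (dom : set H) (A : H -> H)
    (d : measure_display) (M : measurableType d)
    (mu : {measure set M -> \bar R})
    (lambda : {mfun M >-> R}) (hat : H -> LspaceType2 mu) : Prop := {
  spec_lambda_ge0 : forall xi, 0 <= lambda xi;
  spec_linear : forall (a : R) x y,
    {ae mu, forall xi, hat (a *: x + y) xi = a * hat x xi + hat y xi};
  spec_isometry : forall x,
    ('N[mu]_2[EFin \o hat x] = `|x|%:E)%E;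
  spec_bijective : bijective hat;
  spec_dom : forall x, dom x <->
    (\int[mu]_xi ((lambda xi ^+ 2 * hat x xi) ^+ 2)%:E < +oo)%E;
  spec_mul : forall x, dom x ->
    {ae mu, forall xi, hat (A x) xi = lambda xi ^+ 2 * hat x xi} }.

(* f has derivative g at each point of D, relative to D (hence one-sided at a
   boundary point of an interval D). *)
Definition derivative_on (R : realType) (D : set R) (f g : R -> R) : Prop :=
  forall t, D t ->
    (s - t)^-1 * (f s - f t) @[s --> within D t^'] --> g t.

(* Vectors, including those that need not lie in H (the solution is a priori
   only a curve of ultradistributions), are represented through the spectral
   identification by real-valued measurable functions on M. *)
Section SpectralSide.
Context (R : realType) (d : measure_display) (M : measurableType d).
Variables (mu : {measure set M -> \bar R}) (lambda : {mfun M >-> R}).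

(* |f|^2 for the norm of H = L^2(M, mu). *)
Definition norm2 (f : M -> R) : \bar R :=
  ('N[mu]_2[EFin \o f] ^+ 2)%E.

(* A is multiplication by lambda^2, so A^alpha is multiplication by
   lambda^(2 alpha). *)
Definition frac_pow (alpha : R) (f : M -> R) : M -> R :=
  fun xi => lambda xi `^ (2 * alpha) * f xi.

Definition frac_dom (alpha : R) (f : M -> R) : Prop :=
  (\int[mu]_xi ((1 + lambda xi) `^ (4 * alpha) * f xi ^+ 2)%:E < +oo)%E.

(* u_{nu,+} *)
Definition high_freq (nu : R) (f : M -> R) : M -> R :=
  fun xi => if nu <= lambda xi then f xi else 0.

Section Gevrey.
Variables (phi : R -> R) (r alpha : R).

Definition gevrey_norm2 (f : M -> R) : \bar R :=
  \int[mu]_xi ((1 + lambda xi) `^ (4 * alpha) * f xi ^+ 2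
               * expR (2 * r * phi (lambda xi)))%:E.

Definition gevrey : set {mfun M >-> R} := [set f | (gevrey_norm2 f < +oo)%E].

Definition gevrey_C0_on (D : set R) (u : R -> {mfun M >-> R}) : Prop :=
  (forall t, D t -> gevrey (u t)) /\
  (forall t, D t ->
     gevrey_norm2 (fun xi => u s xi - u t xi) @[s --> within D (nbhs t)]
       --> 0%E).

(* u is of class C^1 on D, with derivative v. *)
Definition gevrey_C1_on (D : set R) (u v : R -> {mfun M >-> R}) : Prop :=
  [/\ gevrey_C0_on D u, gevrey_C0_on D v &
      forall t, D t ->
        gevrey_norm2 (fun xi => (s - t)^-1 * (u s xi - u t xi) - v t xi)
          @[s --> within D t^'] --> 0%E].

End Gevrey.

(* u \in C^0((0,+oo), G_{phi, r t, alpha}) *)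
Definition gevrey_C0 (phi : R -> R) (r alpha : R)
    (u : R -> {mfun M >-> R}) : Prop :=
  forall tau, 0 < tau -> gevrey_C0_on phi (r * tau) alpha `[tau, +oo[ u.

(* u \in C^1((0,+oo), G_{phi, r t, alpha}), with derivative v *)
Definition gevrey_C1 (phi : R -> R) (r alpha : R)
    (u v : R -> {mfun M >-> R}) : Prop :=
  forall tau, 0 < tau -> gevrey_C1_on phi (r * tau) alpha `[tau, +oo[ u v.

(* u is the solution of u'' + 2 delta A^sigma u' + c A u = 0 with data f0, f1,
   and v is its time derivative.  The functions u t and v t are representatives
   chosen so that, for almost every xi, the curves t |-> u t xi and
   t |-> v t xi are meaningful for all t >= 0 at once. *)
Definition is_solution (delta sigma : R) (c : R -> R) (f0 f1 : M -> R)
    (u v : R -> {mfun M >-> R}) : Prop :=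
  {ae mu, forall xi,
    [/\ u 0 xi = f0 xi, v 0 xi = f1 xi,
        derivative_on `[0, +oo[ (fun t => u t xi) (fun t => v t xi) &
        exists2 w : R -> R, derivative_on `[0, +oo[ (fun t => v t xi) w &
          forall t, 0 <= t ->
            w t + 2 * delta * lambda xi `^ (2 * sigma) * v t xi
              + lambda xi ^+ 2 * c t * u t xi = 0]}.

End SpectralSide.

(* Main.v *)
Require Import Defs.
From HB Require Import structures.
From mathcomp Require Import all_boot all_order all_algebra.
From mathcomp Require Import all_classical all_reals all_analysis.
From mathcomp Require Import measurable_realfun ring lra.

Set Implicit Arguments.
Unset Strict Implicit.
Unset Printing Implicit Defensive.
Import Order.TTheory GRing.Theory Num.Theory.
Import numFieldNormedType.Exports.

Local Open Scope classical_set_scope.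
Local Open Scope ring_scope.

(** Each spectral component solves y'' + 2 D y' + l^2 c y = 0 with l = lambda
    and D = delta l^(2 sigma).  If C is a regularization of c at scale 1/l, then
    (y' + D y)^2 + D^2 y^2 + l^2 C y^2 has derivative
      - 2 D y'^2 - 2 D l^2 c y^2 + 2 l^2 (C - c) y y' + l^2 C' y^2.
    Since |C - c| <= omega(1/l) and |C'| <= l omega(1/l), dividing by
    l^(2 sigma) leaves a quadratic form in (y', l y) which, for large l, is
    uniformly negative definite precisely because
    4 delta^2 mu1 > Lambda^2 + 2 delta Lambda.  Hence the energy decays like
    exp(- 2 r l^(2 sigma) t).  Integrating over the high frequencies gives the
    Gevrey estimate; the low frequencies obey a Gronwall bound, and continuity
    and differentiability in time follow by dominated convergence. *)

(** * From the limit superior to a local bound on the modulus *)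

Lemma limf_esup_lt (T : choiceType) (X : filteredType T) (R : realType)
    (f : X -> \bar R) (F : set_system X) (l : \bar R) :
  (limf_esup f F < l)%E -> exists2 V, F V & forall x, V x -> (f x <= l)%E.
Proof.
move=> /ereal_inf_lt [_ [V FV <-] Vl]; exists V => // x Vx.
by apply: le_trans (ltW Vl); apply: ereal_sup_ubound; exists x.
Qed.

(** The strict inequality leaves room to replace the limit superior by a slightly larger real [L],
    which bounds the ratio itself near 0. *)
Lemma limsup_ratio_bound (R : realType) (omega : R -> R) (p b m : R) :
  continuity_modulus omega -> 0 <= b ->
  (let Lambda := limf_esup (fun e : R => (omega e / e `^ p)%:E) 0^'+ in
   Lambda ^+ 2 + b%:E * Lambda < m%:E)%E ->
  exists L e0 : R, [/\ 0 <= L, L ^+ 2 + b * L < m, 0 < e0 &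
    forall e, 0 < e -> e < e0 -> omega e <= L * e `^ p].
Proof.
move=> om b0; set Lam := limf_esup _ _ => /= Lm.
have L0 : (0 <= Lam)%E.
  apply: le_ereal_inf_tmp => _ [V V0 <-].
  have [e /= e0 eV] := V0.
  have eV2 : V (e / 2).
    apply: eV; rewrite /= ?divr_gt0// sub0r normrN gtr0_norm ?divr_gt0//.
    by rewrite ltr_pdivrMr// ltr_pMr// ltr1n.
  apply: le_trans (ereal_sup_ubound _); last by exists (e / 2).
  by rewrite lee_fin divr_ge0// ?powR_ge0// ltW// modulus_gt0// divr_gt0.
(* An infinite [Lam] would make the left-hand side infinite; for [b = 0] the product [b * Lam] is 0
   by convention and the square alone is infinite. *)
have Lfin : Lam \is a fin_num.
  move: L0 Lm; case: Lam => [r| |]// _.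
  rewrite mulyy; have [->|b1] := eqVneq b 0; first by rewrite mul0e adde0.
  by rewrite gt0_muley ?lte_fin ?lt_def ?b1.
move: L0 Lm; rewrite -(fineK Lfin); set l := fine Lam => l0.
rewrite -!EFinM -EFinD lte_fin -expr2 => lm.
rewrite lee_fin in l0.
pose g := m - l ^+ 2 - b * l; have g0 : 0 < g by rewrite /g; lra.
(* Since [h <= 1], passing from [l] to [l + h] raises [l ^+ 2 + b * l] by at most
   [h * (2 * l + 1 + b)], which this choice keeps within half of the gap [g]. *)
pose h := Num.min 1 (g / (2 * (2 * l + 1 + b))).
have d0 : 0 < 2 * (2 * l + 1 + b) by lra.
have h0 : 0 < h by rewrite lt_min ltr01 divr_gt0.
have h1 : h <= 1 by rewrite ge_min lexx.
have hg : h * (2 * (2 * l + 1 + b)) <= g.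
  by rewrite -ler_pdivlMr// ge_min lexx orbT.
have [V [e /= e0 eV] Vl] : exists2 V, nbhs (0:R)^'+ V &
    forall x, V x -> ((omega x / x `^ p)%:E <= (l + h)%:E)%E.
  by apply: limf_esup_lt; rewrite -/Lam -(fineK Lfin) lte_fin ltrDl.
exists (l + h), e; split => //; first lra.
  have : h * h <= h by rewrite ler_piMl// ltW.
  rewrite /g in hg; nra.
move=> x x0 xe; have /Vl : V x.
  by apply: eV => //=; rewrite sub0r normrN gtr0_norm.
by rewrite lee_fin ler_pdivrMr// powR_gt0.
Qed.

(** * Relative derivatives and a Gronwall inequality *)

Lemma derivative_on_cvg (R : realType) (D : set R) (f g : R -> R) (t : R) :
  derivative_on D f g -> D t -> f s @[s --> within D (nbhs t)] --> f t.
Proof.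
move=> fg Dt; apply/cvgrPdist_le => e e0.
have /cvgrPdist_le/(_ 1 ltr01) [r /= r0 rB] := fg t Dt.
(* Near [t] the quotient stays within 1 of [g t], so [K] is a Lipschitz constant of [f] at [t]. *)
pose K := `|g t| + 1; have K0 : 0 < K by rewrite ltr_wpDl.
exists (Num.min r (e / K)); first by rewrite /= lt_min r0 divr_gt0.
move=> s /=; rewrite lt_min => /andP[sr se] Ds.
have [->|st] := eqVneq s t; first by rewrite subrr normr0 ltW.
have st0 : s - t != 0 by rewrite subr_eq0.
have := rB s sr st Ds; set q := _ * (f s - f t) => qg.
have -> : f t - f s = q * (t - s) by rewrite /q; field.
rewrite normrM; have qK : `|q| <= K.
  rewrite -[q](subrK (g t)) /K addrC (le_trans (ler_normD _ _))//.
  by rewrite lerD2l distrC.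
apply: le_trans (_ : K * (e / K) <= e); last by rewrite mulrCA divff ?gt_eqF ?mulr1.
by rewrite ler_pM// ltW.
Qed.

Lemma derivative_on_continuous (R : realType) (D A : set R) (f g : R -> R) :
  derivative_on D f g -> A `<=` D -> {within A, continuous f}.
Proof.
move=> fg AD; apply: (continuous_subspaceW AD).
by apply/subspace_continuousP => x Dx; exact: derivative_on_cvg fg Dx.
Qed.

Lemma derivative_on_is_derive (R : realType) (D : set R) (f g : R -> R) (t : R) :
  derivative_on D f g -> nbhs t D -> is_derive t 1 f (g t).
Proof.
move=> fg tD; have Dt := nbhs_singleton tD.
have q_cvg : h^-1 *: ((f \o shift t) (h *: 1) - f t) @[h --> 0^'] --> g t.
  apply/cvgrPdist_le => e e0.
  have /cvgrPdist_le/(_ e e0) [r /= r0 rB] := fg t Dt.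
  have [r' /= r'0 r'D] := tD.
  exists (Num.min r r'); first by rewrite /= lt_min r0.
  move=> h /=; rewrite sub0r normrN lt_min => /andP[hr hr'] h0.
  have := rB (h + t); rewrite addrK [h%:A]mulr1; apply.
  - by rewrite /= opprD addrCA subrr addr0 normrN.
  - by rewrite -subr_eq0 addrK.
  - by apply: r'D; rewrite /= opprD addrCA subrr addr0 normrN.
apply: DeriveDef; first by apply/cvg_ex; exists (g t).
exact/cvg_lim.
Qed.

Lemma nbhs_nonneg (R : realType) (t : R) : 0 < t -> nbhs t (`[0, +oo[%classic : set R).
Proof.
move=> t0; apply: (@filterS _ _ _ [set x | 0 < x]); last exact: lt_nbhsr.
by move=> x /= x0; rewrite in_itv/= andbT ltW.
Qed.

(** Gronwall: [E t * expR (- k * t)] is nonincreasing. The sign of [k] is left free: negative for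
    the damped high frequencies, positive for the low ones. *)
Lemma exp_decay (R : realType) (E dE : R -> R) (k a b : R) : a <= b ->
  {within `[a, b], continuous E} ->
  (forall t, a < t < b -> is_derive t 1 E (dE t)) ->
  (forall t, a < t < b -> dE t <= k * E t) ->
  E b <= E a * expR (k * (b - a)).
Proof.
move=> ab Ec Ed dEk.
pose F t := E t * expR (- k * t).
have Fd t : a < t < b ->
    is_derive t 1 F (E t *: (expR (- k * t) * - k) + expR (- k * t) *: dE t).
  move=> tab; have Edt := Ed t tab; apply: is_deriveM.
  apply: is_derive_eq; rewrite /GRing.scale/=; ring.
have : F b <= F a.
  apply: (@ler0_derive1_le_cc _ F a b); rewrite ?bound_itvE//.
  - move=> x; rewrite in_itv/= => /Fd Fx; exact: ex_derive.
  - move=> x; rewrite in_itv/= => xab; rewrite derive1E (@derive_val _ _ _ _ _ _ _ (Fd x xab)).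
    have := dEk x xab; have := expR_gt0 (- k * x); rewrite /GRing.scale/=.
    set z := expR _ => z0 dx; nra.
  - move=> x; apply: cvgM; first exact: Ec.
    apply: (continuous_subspaceT (f := fun t => expR (- k * t))) => y.
    apply: continuous_comp; last exact: continuous_expR.
    by apply: mulrl_continuous.
rewrite /F => Fab.
have -> : expR (k * (b - a)) = expR (- k * a) / expR (- k * b).
  by rewrite -expRN -expRD; congr expR; ring.
by rewrite mulrA ler_pdivlMr ?expR_gt0.
Qed.

(* With z = lambda^(2 sigma), l = lambda, and C an approximation of c. *)
Definition energy (R : realType) (delta z l C y p : R) : R :=
  (p + delta * z * y) ^+ 2 + (delta * z * y) ^+ 2 + l ^+ 2 * C * y ^+ 2.

(** * Quadratic inequalities for the energy *)

Section Energy.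
Context (R : realType).
Implicit Types (delta mu L z l c C s y p r : R).

(** [k] is determinant over trace of the symmetric matrix with diagonal [a], [b] and off-diagonal
    entry [- L]; when both eigenvalues are positive, this quotient is below the smaller one. *)
Lemma definite_form (a b L : R) : 0 < a -> 0 <= L -> L ^+ 2 < a * b ->
  exists2 k : R, 0 < k &
    forall p q, k * (p ^+ 2 + q ^+ 2) <= a * p ^+ 2 + b * q ^+ 2 - 2 * L * p * q.
Proof.
move=> a0 L0 Lab.
have b0 : 0 < b by rewrite -(pmulr_rgt0 _ a0); nra.
have ab0 : 0 < a + b by lra.
pose k := (a * b - L ^+ 2) / (a + b).
have kE : k * (a + b) = a * b - L ^+ 2 by rewrite divfK ?gt_eqF.
exists k; first by rewrite divr_gt0 ?subr_gt0.
have ak : 0 < a - k.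
  rewrite -(pmulr_lgt0 _ ab0) mulrBl kE; nra.
(* Multiplying by [a - k > 0] allows completing the square in [p]; the coefficient left on [q ^+ 2]
   reduces to [k ^+ 2] by [kE]. *)
move=> p q; rewrite -subr_ge0 -(pmulr_rge0 _ ak).
have -> : (a - k) * (a * p ^+ 2 + b * q ^+ 2 - 2 * L * p * q
      - k * (p ^+ 2 + q ^+ 2)) =
    ((a - k) * p - L * q) ^+ 2
    + (a * b - k * (a + b) + k ^+ 2 - L ^+ 2) * q ^+ 2 by ring.
rewrite kE addr_ge0 ?sqr_ge0// mulr_ge0 ?sqr_ge0//.
have -> : a * b - (a * b - L ^+ 2) + k ^+ 2 - L ^+ 2 = k ^+ 2 by ring.
exact: sqr_ge0.
Qed.

(** Together with [energy_ge], this makes the energy equivalent to [p ^+ 2 + (l * y) ^+ 2], with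
    constants independent of [z], [l] and [C]. The bound [z <= l] absorbs the terms in
    [delta * z * y]. *)
Lemma energy_le delta mu2 z l C y p : 0 <= z <= l -> C <= mu2 ->
  energy delta z l C y p
    <= (2 + 3 * delta ^+ 2 + `|mu2|) * (p ^+ 2 + (l * y) ^+ 2).
Proof.
move=> /andP[z0 zl] Cm; rewrite /energy.
have zy : (z * y) ^+ 2 <= (l * y) ^+ 2.
  by rewrite !exprMn ler_wpM2r ?sqr_ge0// ler_pXn2r// nnegrE// (le_trans z0).
have Cy : l ^+ 2 * C * y ^+ 2 <= `|mu2| * (l * y) ^+ 2.
  rewrite mulrAC -exprMn mulrC ler_wpM2r ?sqr_ge0// (le_trans Cm)//.
  exact: ler_norm.
have dzy : (delta * z * y) ^+ 2 <= delta ^+ 2 * (l * y) ^+ 2.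
  by rewrite -mulrA exprMn ler_wpM2l ?sqr_ge0.
have sq : (p + delta * z * y) ^+ 2 <= 2 * p ^+ 2 + 2 * (delta * z * y) ^+ 2.
  by have := sqr_ge0 (p - delta * z * y); nra.
have m0 : 0 <= `|mu2| * p ^+ 2 by rewrite mulr_ge0 ?sqr_ge0.
have d0 : 0 <= delta ^+ 2 * p ^+ 2 by rewrite mulr_ge0 ?sqr_ge0.
have := sqr_ge0 (l * y); nra.
Qed.

Lemma energy_ge delta mu1 z l C y p : 0 < mu1 -> mu1 <= C ->
  p ^+ 2 + (l * y) ^+ 2 <= (2 + mu1^-1) * energy delta z l C y p.
Proof.
move=> m0 mC; rewrite mulrDl lerD//.
  have : p ^+ 2 <= 2 * (p + delta * z * y) ^+ 2 + 2 * (delta * z * y) ^+ 2.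
    by have := sqr_ge0 (p + 2 * (delta * z * y)); nra.
  have : 0 <= l ^+ 2 * C * y ^+ 2.
    have C0 : 0 <= C by rewrite (le_trans _ mC)// ltW.
    by rewrite mulr_ge0 ?sqr_ge0// mulr_ge0 ?sqr_ge0.
  rewrite /energy; lra.
rewrite ler_pdivlMl// /energy.
have : mu1 * (l * y) ^+ 2 <= l ^+ 2 * C * y ^+ 2.
  by rewrite mulrAC -exprMn [leRHS]mulrC ler_wpM2r ?sqr_ge0.
by have := sqr_ge0 (p + delta * z * y); have := sqr_ge0 (delta * z * y); lra.
Qed.

(** Here [s] stands for the derivative of [C]. Divided by [z], the left-hand side is at most minus a
    quadratic form in the absolute values of [p] and [l * y], with diagonal [2 * delta],
    [2 * delta * mu1 - L] and off-diagonal entry [- L]. The hypothesis on [L] says exactly that its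
    determinant is positive. *)
Lemma energy_dissipation delta mu1 mu2 L : 0 < delta -> 0 <= L ->
  L ^+ 2 + 2 * delta * L < 4 * delta ^+ 2 * mu1 ->
  exists2 r, 0 < r & forall z l c C s y p, 0 < z -> z <= l ->
    mu1 <= c -> C <= mu2 -> l * `|C - c| <= L * z -> `|s| <= L * z ->
    - (2 * delta * z) * p ^+ 2 - 2 * delta * z * l ^+ 2 * c * y ^+ 2
      + 2 * l ^+ 2 * (C - c) * y * p + l ^+ 2 * s * y ^+ 2
    <= - (2 * r * z) * energy delta z l C y p.
Proof.
move=> d0 L0 Lm.
have [||k k0 kP] := @definite_form (2 * delta) (2 * delta * mu1 - L) L _ L0.
- lra.
- nra.
pose M := 2 + 3 * delta ^+ 2 + `|mu2|.
have M0 : 0 < M by rewrite /M; have := sqr_ge0 delta; have := normr_ge0 mu2; lra.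
(* [M] is the constant of [energy_le]: dissipating [k * z] times [p ^+ 2 + (l * y) ^+ 2] dissipates
   at least [2 * r * z] times the energy. *)
exists (k / (2 * M)); first by rewrite divr_gt0// mulr_gt0.
move=> z l c C s y p z0 zl mc Cm Cc sL.
have l0 : 0 < l by exact: lt_le_trans zl.
have EM : energy delta z l C y p <= M * (p ^+ 2 + (l * y) ^+ 2).
  by apply: energy_le; rewrite // ltW.
set E := energy _ _ _ _ _ _ in EM *.
have -> : - (2 * (k / (2 * M)) * z) * E = - (z * k) * (E / M).
  by field; rewrite gt_eqF.
have {}EM : E / M <= p ^+ 2 + (l * y) ^+ 2 by rewrite ler_pdivrMr// mulrC.
apply: (@le_trans _ _ (- (z * k) * (p ^+ 2 + (l * y) ^+ 2))); last first.
  by rewrite ler_nM2l ?oppr_lt0 ?mulr_gt0.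
(* The form is evaluated at absolute values because the cross term in [(C - c) * y * p] has no
   definite sign. *)
have := kP `|p| (l * `|y|).
have -> : `|p| ^+ 2 = p ^+ 2 by rewrite real_normK// num_real.
have -> : (l * `|y|) ^+ 2 = (l * y) ^+ 2 by rewrite !exprMn real_normK// num_real.
move=> /(ler_wpM2l (ltW z0)) kz.
have h1 : 2 * delta * z * mu1 * (l * y) ^+ 2 <= 2 * delta * z * l ^+ 2 * c * y ^+ 2.
  have -> : 2 * delta * z * l ^+ 2 * c * y ^+ 2 = 2 * delta * z * c * (l * y) ^+ 2 by ring.
  by rewrite ler_wpM2r ?sqr_ge0// ler_wpM2l// !mulr_ge0// ltW.
have h2 : 2 * l ^+ 2 * (C - c) * y * p <= 2 * (L * z) * (l * `|y|) * `|p|.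
  apply: le_trans (ler_norm _) _.
  rewrite !normrM (ger0_norm (_ : 0 <= 2))// (gtr0_norm l0).
  have -> : 2 * (l * l) * `|C - c| * `|y| * `|p| =
    2 * (l * `|C - c|) * (l * `|y|) * `|p| by ring.
  rewrite ler_wpM2r// ler_wpM2r//; first by rewrite mulr_ge0// ltW.
  by rewrite ler_wpM2l.
have h3 : l ^+ 2 * s * y ^+ 2 <= L * z * (l * y) ^+ 2.
  rewrite mulrAC -exprMn mulrC ler_wpM2r ?sqr_ge0//.
  exact: le_trans (ler_norm _) sL.
nra.
Qed.

End Energy.

(** The equation eliminates [w]. The square [(delta * z * y) ^+ 2] of the energy serves to cancel
    the term in [(delta * z) ^+ 2 * y * v] that the other square produces. At [t > 0] the relative
    derivatives are two-sided. *)
Lemma energy_derivative (R : realType) (delta z l s : R) (C y v w c : R -> R)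
    (t : R) :
  derivative_on `[0, +oo[ y v -> derivative_on `[0, +oo[ v w ->
  (forall t, 0 <= t -> w t + 2 * (delta * z) * v t + l ^+ 2 * c t * y t = 0) ->
  0 < t -> is_derive t 1 C s ->
  is_derive t 1 (fun t => energy delta z l (C t) (y t) (v t))
    (- (2 * delta * z) * v t ^+ 2 - 2 * delta * z * l ^+ 2 * c t * y t ^+ 2
      + 2 * l ^+ 2 * (C t - c t) * y t * v t + l ^+ 2 * s * y t ^+ 2).
Proof.
move=> yv vw ode t0 Cs.
have dy := derivative_on_is_derive yv (nbhs_nonneg t0).
have dv := derivative_on_is_derive vw (nbhs_nonneg t0).
have wE : w t = - (2 * (delta * z) * v t + l ^+ 2 * c t * y t).
  by apply/eqP; rewrite -subr_eq0 opprK addrA ode// ltW.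
rewrite /energy; apply: is_derive_eq.
rewrite wE /GRing.scale/=; ring.
Qed.

Lemma energy_continuous (R : realType) (delta z l : R) (C y v : R -> R) (A : set R) :
  {within A, continuous C} -> {within A, continuous y} ->
  {within A, continuous v} ->
  {within A, continuous (fun t => energy delta z l (C t) (y t) (v t))}.
Proof.
move=> Cc yc vc x.
have cst k : {within A, continuous (fun=> k : R)} by move=> ?; exact: cvg_cst.
have M (f g : R -> R) : {within A, continuous f} -> {within A, continuous g} ->
    {within A, continuous (fun t => f t * g t)}.
  by move=> fc gc ?; apply: cvgM; [exact: fc|exact: gc].
have D (f g : R -> R) : {within A, continuous f} -> {within A, continuous g} ->
    {within A, continuous (fun t => f t + g t)}.
  by move=> fc gc ?; apply: cvgD; [exact: fc|exact: gc].
rewrite /energy; apply: (D); first apply: (D).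
- by apply: (M); apply: (D) => //; apply: (M).
- by apply: (M); apply: (M).
- by apply: (M); [apply: (M)|apply: (M)].
Qed.

(** * Decay of one component, with the coefficient interpolated at scale [l^-1] *)

Section EnergyDecay.
Context (R : realType) (delta mu1 mu2 L r z l : R) (c y v w : R -> R).
Hypotheses (z0 : 0 < z) (zl : z <= l).
Hypothesis dissipation : forall c C s y p,
  mu1 <= c -> C <= mu2 -> l * `|C - c| <= L * z -> `|s| <= L * z ->
  - (2 * delta * z) * p ^+ 2 - 2 * delta * z * l ^+ 2 * c * y ^+ 2
    + 2 * l ^+ 2 * (C - c) * y * p + l ^+ 2 * s * y ^+ 2
  <= - (2 * r * z) * energy delta z l C y p.
Hypothesis c_itv : forall t, 0 <= t -> mu1 <= c t <= mu2.
Hypothesis c_osc : forall a b, 0 <= a -> 0 <= b -> `|a - b| <= l^-1 ->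
  l * `|c a - c b| <= L * z.
Hypotheses (yv : derivative_on `[0, +oo[ y v) (vw : derivative_on `[0, +oo[ v w).
Hypothesis ode : forall t, 0 <= t ->
  w t + 2 * (delta * z) * v t + l ^+ 2 * c t * y t = 0.

Let l0 : 0 < l. Proof. exact: lt_le_trans zl. Qed.

(* The piecewise linear interpolation of c at the nodes k/l plays the role of
   a regularized coefficient: it is within omega(1/l) of c and its slopes are
   at most l omega(1/l). *)
Let interpol (a t : R) : R := c a + l * (c (a + l^-1) - c a) * (t - a).

Let interpolE a t : interpol a t =
  (1 - l * (t - a)) * c a + l * (t - a) * c (a + l^-1).
Proof. by rewrite /interpol; ring. Qed.

Let interpol_weight a t : a <= t <= a + l^-1 -> 0 <= l * (t - a) <= 1.
Proof.
move=> /andP[at_ ta]; rewrite mulr_ge0 ?subr_ge0// ?(ltW l0)//=.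
by rewrite mulrC -ler_pdivlMr// div1r lerBlDl.
Qed.

Let interpol_itv a t : 0 <= a -> a <= t <= a + l^-1 ->
  mu1 <= interpol a t <= mu2.
Proof.
move=> a0 /interpol_weight; rewrite interpolE; move: (l * (t - a)) => th /andP[t0 t1].
have /andP[? ?] := c_itv a0.
have al0 : 0 <= a + l^-1 by rewrite addr_ge0// invr_ge0 ltW.
have /andP[? ?] := c_itv al0.
apply/andP; split; nra.
Qed.

(** Both nodes lie within [l^-1] of [t], and the interpolation is a convex combination of the nodal
    values, so the oscillation bound carries over with the same constant. *)
Let interpol_near a t : 0 <= a -> a <= t <= a + l^-1 ->
  l * `|interpol a t - c t| <= L * z.
Proof.
move=> a0 ta; have /interpol_weight := ta; rewrite interpolE.
move: (l * (t - a)) => th /andP[t0 t1]; move: ta => /andP[at_ ta].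
have al0 : 0 <= a + l^-1 by rewrite addr_ge0// invr_ge0 ltW.
have tt0 : 0 <= t by exact: le_trans at_.
have h1 : l * `|c a - c t| <= L * z.
  by apply: c_osc => //; rewrite distrC ger0_norm ?subr_ge0// lerBlDl.
have h2 : l * `|c (a + l^-1) - c t| <= L * z.
  by apply: c_osc => //; rewrite ger0_norm ?subr_ge0//; lra.
have -> : (1 - th) * c a + th * c (a + l^-1) - c t =
  (1 - th) * (c a - c t) + th * (c (a + l^-1) - c t) by ring.
apply: le_trans (_ : l * ((1 - th) * `|c a - c t| + th * `|c (a + l^-1) - c t|) <= _).
  rewrite ler_wpM2l ?(ltW l0)// (le_trans (ler_normD _ _))// !normrM.
  by rewrite (ger0_norm t0) ger0_norm ?subr_ge0.
nra.
Qed.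

(** On one cell the interpolation is affine, hence differentiable, and [c_osc] at distance exactly
    [l^-1] bounds its slope as [dissipation] requires. *)
Let energy_step a t : 0 <= a -> a <= t <= a + l^-1 ->
  energy delta z l (interpol a t) (y t) (v t)
    <= energy delta z l (c a) (y a) (v a) * expR (- (2 * r * z) * (t - a)).
Proof.
move=> a0 ta; have /andP[at_ tal] := ta.
have -> : c a = interpol a a by rewrite /interpol subrr mulr0 addr0.
pose dE t := - (2 * delta * z) * v t ^+ 2
      - 2 * delta * z * l ^+ 2 * c t * y t ^+ 2
      + 2 * l ^+ 2 * (interpol a t - c t) * y t * v t
      + l ^+ 2 * (l * (c (a + l^-1) - c a)) * y t ^+ 2.
have sub : `[a, t] `<=` (`[0, +oo[%classic : set R).
  by move=> x /=; rewrite !in_itv/= andbT => /andP[+ _]; exact: le_trans.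
apply: (@exp_decay _ (fun t => energy delta z l (interpol a t) (y t) (v t)) dE) => //.
- apply: energy_continuous.
  + apply: continuous_subspaceT => x; apply: cvgD; first exact: cvg_cst.
    by apply: cvgM; [exact: cvg_cst|apply: cvgB; [exact: cvg_id|exact: cvg_cst]].
  + exact: derivative_on_continuous yv sub.
  + exact: derivative_on_continuous vw sub.
- move=> s /andP[as_ st]; apply: energy_derivative yv vw ode _ _.
    exact: le_lt_trans as_.
  by apply: is_derive_eq; rewrite /GRing.scale/=; ring.
- move=> s /andP[as_ st]; apply: dissipation.
  + by have /andP[] := c_itv (ltW (le_lt_trans a0 as_)).
  + by have /andP[] : mu1 <= interpol a s <= mu2
      by apply: interpol_itv; rewrite // (ltW as_)/= (le_trans (ltW st)).
  + by apply: interpol_near; rewrite // (ltW as_)/= (le_trans (ltW st)).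
  + rewrite normrM (gtr0_norm l0); apply: c_osc => //.
      by rewrite addr_ge0// invr_ge0 ltW.
    by rewrite addrC addKr ger0_norm// invr_ge0 ltW.
Qed.

(** Interpolations on adjacent cells both equal [c] at the common node, so the energy does not jump
    there and the decay factors multiply. *)
Let energy_node (k : nat) :
  energy delta z l (c (k%:R / l)) (y (k%:R / l)) (v (k%:R / l))
    <= energy delta z l (c 0) (y 0) (v 0) * expR (- (2 * r * z) * (k%:R / l)).
Proof.
elim: k => [|k IH]; first by rewrite mul0r mulr0 expR0 mulr1.
have kl0 : 0 <= k%:R / l by rewrite divr_ge0// ltW.
have kE : k.+1%:R / l = k%:R / l + l^-1 by rewrite -natr1 mulrDl mul1r.
have := @energy_step (k%:R / l) (k.+1%:R / l) kl0.
have -> : interpol (k%:R / l) (k.+1%:R / l) = c (k.+1%:R / l).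
  rewrite kE /interpol; have -> (a : R) : a + l^-1 - a = l^-1 by ring.
  by field; rewrite gt_eqF.
rewrite {1 2}kE lexx lerDl invr_ge0 (ltW l0) => /(_ isT) /le_trans; apply.
have -> : expR (- (2 * r * z) * (k.+1%:R / l)) = expR (- (2 * r * z) * (k%:R / l))
    * expR (- (2 * r * z) * (k.+1%:R / l - k%:R / l)).
  by rewrite -expRD; congr expR; ring.
rewrite mulrA ler_wpM2r// expR_ge0.
Qed.

Lemma component_energy_decay (t : R) : 0 < mu1 -> 0 <= t ->
  v t ^+ 2 + (l * y t) ^+ 2 <= (2 + mu1^-1) * (2 + 3 * delta ^+ 2 + `|mu2|)
    * (v 0 ^+ 2 + (l * y 0) ^+ 2) * expR (- (2 * r * z * t)).
Proof.
(* [k%:R / l] is the last node not after [t]: [k] whole cells and a partial one lead from 0 to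
   [t]. *)
move=> m0 t0; pose k := Num.truncn (t * l).
have tl0 : 0 <= t * l by rewrite mulr_ge0// ltW.
have /andP[k1 k2] := truncn_itv tl0; rewrite -/k in k1 k2.
have kl0 : 0 <= k%:R / l by rewrite divr_ge0// ltW.
have ta : k%:R / l <= t <= k%:R / l + l^-1.
  have -> : k%:R / l + l^-1 = k.+1%:R / l by rewrite -natr1 mulrDl mul1r.
  by rewrite ler_pdivrMr// k1/= ler_pdivlMr// ltW.
have /andP[C1 C2] := interpol_itv kl0 ta.
apply: le_trans (energy_ge delta z l (y t) (v t) m0 C1) _.
rewrite -[X in _ <= X * _]mulrA -[leRHS]mulrA ler_wpM2l ?addr_ge0 ?invr_ge0 ?(ltW m0)//.
apply: le_trans (energy_step kl0 ta) _.
apply: (@le_trans _ _ (energy delta z l (c 0) (y 0) (v 0)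
    * expR (- (2 * r * z) * (k%:R / l)) * expR (- (2 * r * z) * (t - k%:R / l)))).
  by rewrite ler_wpM2r ?expR_ge0// energy_node.
rewrite -mulrA -expRD -mulrDr addrC subrK mulNr.
rewrite ler_wpM2r ?expR_ge0// energy_le// ?(ltW z0)//.
by have /andP[] := c_itv (lexx 0).
Qed.

End EnergyDecay.

(** * Estimates for a single oscillator at high and at low frequency *)

Definition oscillator (R : realType) (delta sigma : R) (c : R -> R) (lam : R)
    (y v : R -> R) : Prop :=
  derivative_on `[0, +oo[ y v /\
  exists2 w : R -> R, derivative_on `[0, +oo[ v w &
    forall t, 0 <= t ->
      w t + 2 * delta * lam `^ (2 * sigma) * v t + lam ^+ 2 * c t * y t = 0.

Section Oscillator.
Context (R : realType) (omega : R -> R) (mu1 mu2 sigma delta : R).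

(** Beyond [nu] the scale [lam^-1] lies where [omega] is controlled by [L], and this is the
    oscillation bound that the energy argument asks for. All constants are fixed before [c] is
    given. *)
Lemma high_frequency_decay :
  continuity_modulus omega -> 0 < mu1 -> 0 < sigma -> sigma <= 1 / 2 ->
  0 < delta ->
  (let Lambda := limf_esup
       (fun eps : R => (omega eps / eps `^ (1 - 2 * sigma))%:E) 0^'+ in
   Lambda ^+ 2 + (2 * delta)%:E * Lambda < (4 * delta ^+ 2 * mu1)%:E)%E ->
  exists r nu K : R, [/\ 0 < r, 1 <= nu, 0 < K &
    forall c lam y v, (forall t, 0 <= t -> mu1 <= c t <= mu2) ->
      (forall a b, 0 <= a -> 0 <= b -> `|c a - c b| <= omega `|a - b|) ->
      nu <= lam -> oscillator delta sigma c lam y v ->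
      forall t, 0 <= t -> v t ^+ 2 + (lam * y t) ^+ 2 <=
        K * (v 0 ^+ 2 + (lam * y 0) ^+ 2)
          * expR (- (2 * r * lam `^ (2 * sigma) * t))].
Proof.
move=> om m1 s0 s12 d0 Lam.
have [|L [e0 [L0 Lm e00 omL]]] := limsup_ratio_bound om _ Lam.
  by rewrite mulr_ge0// ltW.
have [r r0 rP] := energy_dissipation mu2 d0 L0 Lm.
(* [1 <= lam] and [2 * sigma <= 1] give [z <= l] for the energy; [2 / e0 <= lam] gives
   [lam^-1 <= e0 / 2 < e0]. The last witness is the product of the constants of [energy_ge] and
   [energy_le]. *)
exists r, (Num.max 1 (2 / e0)), ((2 + mu1^-1) * (2 + 3 * delta ^+ 2 + `|mu2|)).
split => //.
- by rewrite le_max lexx.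
- have := sqr_ge0 delta; have := normr_ge0 mu2 => h1 h2.
  by rewrite mulr_gt0//; [rewrite addr_gt0// invr_gt0|lra].
move=> c lam y v c_itv c_mod; rewrite ge_max => /andP[lam1 lame].
move=> [yv [w vw ode]] t t0.
have lam0 : 0 < lam by exact: lt_le_trans lam1.
have z0 : 0 < lam `^ (2 * sigma) by rewrite powR_gt0.
have zl : lam `^ (2 * sigma) <= lam.
  have := ler_powR lam1 (_ : 2 * sigma <= 1); rewrite powRr1 ?(ltW lam0)//.
  by apply; lra.
have omlam : lam * omega lam^-1 <= L * lam `^ (2 * sigma).
  have ile : lam^-1 < e0.
    rewrite invf_plt// (lt_le_trans _ lame)// ltr_pMl ?invr_gt0 ?ltr1n//.
  apply: le_trans (_ : lam * (L * lam^-1 `^ (1 - 2 * sigma)) <= _).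
    by rewrite ler_wpM2l ?(ltW lam0)// omL// invr_gt0.
  (* The powers of [lam] combine through [1 - (1 - 2 * sigma) = 2 * sigma]. *)
  rewrite -powR_inv1 ?(ltW lam0)// -powRrM mulrCA ler_wpM2l//.
  rewrite -{1}[lam]powRr1 ?(ltW lam0)// -powRD; last first.
    by apply/implyP => _; rewrite gt_eqF.
  by rewrite le_eqVlt; apply/orP; left; apply/eqP; congr (_ `^ _); ring.
apply: (component_energy_decay (mu1 := mu1) (L := L) (w := w) (c := c)) => //.
- by move=> *; exact: rP.
- move=> a b a0 b0 ab; apply: le_trans omlam.
  rewrite ler_wpM2l ?(ltW lam0)// (le_trans (c_mod a b a0 b0))//.
  exact: modulus_nondecreasing.
- by move=> s /ode; rewrite (mulrA 2 delta).
Qed.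

(** The plain sum of squares replaces the energy because [lam] may vanish, and then [lam * y] does
    not control [y]. Damping only decreases this sum, and [lam ^+ 2 * c] is at most
    [nu ^+ 2 * mu2]. *)
Lemma low_frequency_growth (nu lam : R) (c y v : R -> R) (t : R) :
  0 < mu1 -> 0 <= delta -> 0 <= lam <= nu ->
  (forall t, 0 <= t -> mu1 <= c t <= mu2) ->
  oscillator delta sigma c lam y v -> 0 <= t ->
  v t ^+ 2 + y t ^+ 2 <=
    (v 0 ^+ 2 + y 0 ^+ 2) * expR ((1 + nu ^+ 2 * mu2) * t).
Proof.
move=> m1 d0 /andP[l0 ln] c_itv [yv [w vw ode]] t0.
have sub : `[0, t] `<=` (`[0, +oo[%classic : set R).
  by move=> x /=; rewrite !in_itv/= andbT => /andP[].
rewrite -[X in expR (_ * X)]subr0.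
pose dE s := 2 * v s * w s + 2 * y s * v s.
apply: (@exp_decay _ (fun s => v s ^+ 2 + y s ^+ 2) dE) => //.
- have yc := derivative_on_continuous yv sub.
  have vc := derivative_on_continuous vw sub.
  by move=> x; apply: cvgD; apply: cvgM; do [exact: yc|exact: vc].
- move=> s /andP[s0 st].
  have dy := derivative_on_is_derive yv (nbhs_nonneg s0).
  have dv := derivative_on_is_derive vw (nbhs_nonneg s0).
  by apply: is_derive_eq; rewrite /dE /GRing.scale/=; ring.
- move=> s /andP[s0 st]; have /andP[c1 c2] := c_itv s (ltW s0).
  have := ode s (ltW s0); rewrite /dE; set z := _ `^ _ => odes.
  have z0 : 0 <= z by exact: powR_ge0.
  have wE : w s = - (2 * delta * z * v s + lam ^+ 2 * c s * y s).
    by apply/eqP; rewrite -subr_eq0 opprK addrA odes.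
  rewrite wE; have : lam ^+ 2 * c s <= nu ^+ 2 * mu2.
    rewrite ler_pM ?sqr_ge0//; first by rewrite (le_trans (ltW m1)).
    by rewrite ler_pXn2r ?nnegrE// (le_trans l0).
  have : 0 <= lam ^+ 2 * c s by rewrite mulr_ge0 ?sqr_ge0// (le_trans (ltW m1)).
  move: (lam ^+ 2 * c s) (nu ^+ 2 * mu2) => k m k0 km.
  have : 0 <= delta * z * v s ^+ 2 by rewrite mulr_ge0 ?sqr_ge0// mulr_ge0.
  have := sqr_ge0 (y s + v s); have := sqr_ge0 (y s - v s) => h1 h2 h3.
  have : 0 <= (m - k) * (v s ^+ 2 + y s ^+ 2).
    by rewrite mulr_ge0 ?subr_ge0// addr_ge0 ?sqr_ge0.
  have : 0 <= k * (y s + v s) ^+ 2 by rewrite mulr_ge0 ?sqr_ge0.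
  lra.
Qed.

(** By the mean value theorem; it turns difference quotients in time into velocities, so that a
    bound on [v] dominates them. *)
Lemma oscillator_slope (lam t s : R) (c y v : R -> R) :
  oscillator delta sigma c lam y v -> 0 <= s -> 0 <= t -> s != t ->
  exists2 a, Num.min s t <= a <= Num.max s t & (s - t)^-1 * (y s - y t) = v a.
Proof.
move=> [yv _]; wlog st : s t / s < t.
  move=> H s0 t0 st; have := st; rewrite neq_lt => /orP[/H|/H].
    exact.
  rewrite eq_sym in st; case/(_ t0 s0 st) => a; rewrite minC maxC => at_ va.
  by exists a => //; rewrite -va -[t - s]opprB -[y t - _]opprB invrN mulrNN.
move=> s0 t0 _; rewrite (min_idPl (ltW st)) (max_idPr (ltW st)).
have [x||a] := @MVT _ y v s t st.
- rewrite in_itv/= => /andP[sx _].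
  by apply: (derivative_on_is_derive yv); exact: nbhs_nonneg (le_lt_trans s0 sx).
- apply: derivative_on_continuous yv _ => x /=.
  by rewrite !in_itv/= andbT => /andP[+ _]; exact: le_trans.
rewrite in_itv/= => /andP[sa at_] yts; exists a; first by rewrite !ltW.
have -> : y s - y t = v a * (s - t) by rewrite -[s - t]opprB mulrN -yts opprB.
by rewrite mulrC mulfK// subr_eq0 lt_eqF.
Qed.

End Oscillator.

(** * Dominated convergence in a real time parameter *)

Lemma within_dnbhs (T : topologicalType) (D : set T) (t : T) :
  within D t^' = within (D `&` [set s | s != t]) (nbhs t).
Proof.
rewrite /dnbhs /within; apply/funext => A /=; apply/propext.
split=> H.
  have : nbhs t [set x | x != t -> D x -> A x] := H.
  by apply: (@filterS _ (nbhs t)) => x h [Dx xt]; exact: h.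
have : nbhs t [set x | (D `&` [set s | s != t]) x -> A x] := H.
by apply: (@filterS _ (nbhs t)) => x h xt Dx; exact: h.
Qed.

(** Sequential dominated convergence applies along sequences of [P] tending to [t]; if the limit
    failed, such a sequence could be chosen with integrals outside a fixed ball around 0. *)
Lemma dominated_cvg_within (R : realType) (d : measure_display)
    (M : measurableType d) (mu : {measure set M -> \bar R})
    (P : set R) (t e : R) (F : R -> M -> R) (G : M -> R) :
  0 < e -> (forall s, measurable_fun setT (F s)) ->
  (forall s xi, 0 <= F s xi) -> mu.-integrable setT (EFin \o G) ->
  {ae mu, forall xi, forall s, P s -> `|s - t| < e -> F s xi <= G xi} ->
  {ae mu, forall xi, F s xi @[s --> within P (nbhs t)] --> 0} ->
  (\int[mu]_xi (F s xi)%:E)%E @[s --> within P (nbhs t)] --> 0%E.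
Proof.
move=> e0 mF F0 iG FG Fcvg.
have Fint0 s : (0 <= \int[mu]_xi (F s xi)%:E)%E.
  by apply: integral_ge0 => xi _; rewrite lee_fin.
have seqcvg (s : nat -> R) : (forall n, P (s n)) -> (forall n, `|s n - t| < e) ->
    s n @[n --> \oo] --> t ->
    (\int[mu]_xi (F (s n) xi)%:E)%E @[n --> \oo] --> 0%E.
  move=> sP se st; have [||||_ _] := @dominated_convergence _ _ _ mu setT measurableT
    (fun n xi => (F (s n) xi)%:E) (cst 0%E) (EFin \o G) _ _ _ iG.
  - by move=> n; apply/measurable_EFinP.
  - exact: measurable_cst.
  - apply: filterS Fcvg => xi cvgxi _; apply: cvg_EFin; first exact: nearW.
    apply: (cvg_comp _ _ _ cvgxi) => A; rewrite /within /= => tA.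
    have stA : nbhs \oo [set n | P (s n) -> A (s n)] := st _ tA.
    by apply: filterS stA => n /=; apply.
  - apply: filterS FG => xi FG n _.
    by rewrite gee0_abs ?lee_fin// FG.
  by rewrite integral0.
apply/cvg_ballP => eps eps0.
apply: contrapT => notnear.
(* The radius [e] keeps the chosen points where the domination holds, and [n.+1%:R^-1] forces them
   to converge to [t]. *)
have pick n : exists s, [/\ P s, `|s - t| < Num.min e n.+1%:R^-1 &
    ~ ball (0%E : \bar R) eps (\int[mu]_xi (F s xi)%:E)%E].
  apply: contrapT => npick; apply: notnear.
  exists (Num.min e n.+1%:R^-1); first by rewrite /= lt_min e0 invr_gt0 ltr0n.
  move=> s /=; rewrite distrC => st Ps; apply: contrapT => nb.
  by apply: npick; exists s.
have /choice[s sP] := pick.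
have st : s n @[n --> \oo] --> t.
  apply/cvgrPdist_lt => r r0.
  have [N rN] : exists N, N.+1%:R^-1 < r.
    exists (Num.truncn r^-1); rewrite invf_plt ?posrE//.
    exact: truncnS_gt.
  near=> n; have [_ + _] := sP n; rewrite distrC lt_min => /andP[_] /lt_trans; apply.
  apply: le_lt_trans rN; rewrite lef_pV2 ?posrE// ler_nat ltnS.
  by near: n; exact: nbhs_infty_ge.
have /cvg_ballP/(_ eps eps0)[N _ /(_ N (leqnn N))] :
    (\int[mu]_xi (F (s n) xi)%:E)%E @[n --> \oo] --> 0%E.
  apply: seqcvg => // n; first by have [] := sP n.
  by have [_ + _] := sP n; rewrite lt_min => /andP[].
by have [_ _] := sP N.
Unshelve. all: by end_near. Qed.

(** Above [nu], the decay reached at [t >= tau] compensates the Gevrey weight of exponent [r * tau].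
    Below [nu] that weight is bounded, and growth up to time [T] costs only a constant. *)
Lemma oscillator_gevrey_bound (R : realType) (mu1 mu2 sigma delta r nu K : R)
    (c : R -> R) (tau T : R) :
  0 < mu1 -> 0 < sigma -> 0 < delta -> 0 < r -> 1 <= nu -> 0 < K ->
  (forall t, 0 <= t -> mu1 <= c t <= mu2) ->
  (forall lam y v, nu <= lam -> oscillator delta sigma c lam y v ->
     forall t, 0 <= t -> v t ^+ 2 + (lam * y t) ^+ 2 <=
       K * (v 0 ^+ 2 + (lam * y 0) ^+ 2)
         * expR (- (2 * r * lam `^ (2 * sigma) * t))) ->
  0 <= tau ->
  exists2 C, 0 <= C & forall lam y v, 0 <= lam ->
    oscillator delta sigma c lam y v -> forall t, tau <= t <= T ->
    (v t ^+ 2 + (1 + lam) ^+ 2 * y t ^+ 2)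
      * expR (2 * (r * tau) * lam `^ (2 * sigma))
    <= C * (v 0 ^+ 2 + (1 + lam) ^+ 2 * y 0 ^+ 2).
Proof.
move=> m1 s0 d0 r0 nu1 K0 c_itv decay tau0.
(* The low-frequency constant: the weight [(1 + lam) ^+ 2], the growth factor up to [T] and the
   Gevrey weight, each at its largest for [lam <= nu]. *)
pose Cl := (1 + nu) ^+ 2 * expR ((1 + nu ^+ 2 * mu2) * T)
  * expR (2 * (r * tau) * nu `^ (2 * sigma)).
have Cl0 : 0 <= Cl by rewrite mulr_ge0 ?expR_ge0// mulr_ge0 ?expR_ge0 ?sqr_ge0.
exists (4 * K + Cl); first by rewrite addr_ge0// mulr_ge0// ltW.
move=> lam y v lam0 osc t /andP[taut tT]; have t0 := le_trans tau0 taut.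
have N0 p x : 0 <= p ^+ 2 + (1 + lam) ^+ 2 * x ^+ 2 :> R.
  by rewrite addr_ge0 ?sqr_ge0// mulr_ge0 ?sqr_ge0.
set z := lam `^ _; have z0 : 0 <= z by exact: powR_ge0.
have [nl|ln] := leP nu lam.
  apply: (@le_trans _ _ (4 * K * (v 0 ^+ 2 + (1 + lam) ^+ 2 * y 0 ^+ 2))); last first.
    by rewrite ler_wpM2r// lerDl.
  rewrite -ler_pdivlMr ?expR_gt0// -expRN.
  have lam1 : 1 <= lam by exact: le_trans nl.
  (* The factor 4 comes from [1 + lam <= 2 * lam], valid since [1 <= lam]. *)
  have l4 x : (1 + lam) ^+ 2 * x ^+ 2 <= 4 * (lam * x) ^+ 2.
    have -> : 4 * (lam * x) ^+ 2 = (2 * lam) ^+ 2 * x ^+ 2 by ring.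
    rewrite ler_wpM2r ?sqr_ge0// ler_pXn2r// ?nnegrE; lra.
  apply: (@le_trans _ _ (4 * (v t ^+ 2 + (lam * y t) ^+ 2))).
    by have := l4 (y t); have := sqr_ge0 (v t); lra.
  rewrite -[X in _ <= X * _]mulrA -[leRHS]mulrA ler_wpM2l// (le_trans (decay _ _ _ nl osc t t0))//.
  rewrite -/z ler_pM ?expR_ge0//.
  - by rewrite mulr_ge0 ?(ltW K0)// addr_ge0 ?sqr_ge0.
  - rewrite ler_wpM2l ?(ltW K0)// lerD2l exprMn ler_wpM2r ?sqr_ge0//.
    by rewrite ler_pXn2r// ?nnegrE; lra.
  - rewrite ler_expR lerN2 (_ : 2 * (r * tau) * z = 2 * r * z * tau); last by ring.
    by rewrite ler_wpM2l// !mulr_ge0// ltW.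
apply: (@le_trans _ _ (Cl * (v 0 ^+ 2 + (1 + lam) ^+ 2 * y 0 ^+ 2))); last first.
  by rewrite ler_wpM2r// lerDr mulr_ge0// ltW.
have nu0 : 0 <= nu by lra.
have m20 : 0 <= mu2.
  by have /andP[] := c_itv 0 (lexx 0); lra.
have expz : expR (2 * (r * tau) * z) <= expR (2 * (r * tau) * nu `^ (2 * sigma)).
  rewrite ler_expR ler_wpM2l//; first by rewrite !mulr_ge0// ltW.
  by rewrite ge0_ler_powR ?nnegrE ?mulr_ge0// ltW.
have growth : v t ^+ 2 + y t ^+ 2 <= (v 0 ^+ 2 + y 0 ^+ 2) * expR ((1 + nu ^+ 2 * mu2) * t).
  by apply: (low_frequency_growth m1 (ltW d0) _ c_itv osc t0); rewrite lam0 ltW.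
have expt : expR ((1 + nu ^+ 2 * mu2) * t) <= expR ((1 + nu ^+ 2 * mu2) * T).
  by rewrite ler_expR ler_wpM2l// addr_ge0// mulr_ge0 ?sqr_ge0.
have l1 p x : p ^+ 2 + x ^+ 2 <= p ^+ 2 + (1 + lam) ^+ 2 * x ^+ 2.
  by rewrite lerD2l ler_peMl ?sqr_ge0// exprn_ege1// lerDl.
have l2 p x : p ^+ 2 + (1 + lam) ^+ 2 * x ^+ 2 <= (1 + nu) ^+ 2 * (p ^+ 2 + x ^+ 2).
  rewrite mulrDr lerD//; first by rewrite ler_peMl ?sqr_ge0// exprn_ege1// lerDl.
  by rewrite ler_wpM2r ?sqr_ge0// ler_pXn2r// ?nnegrE; lra.
rewrite /Cl [leRHS]mulrAC ler_pM ?expR_ge0// (le_trans (l2 _ _))//.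
rewrite -[leRHS]mulrA ler_wpM2l ?sqr_ge0// (le_trans growth)// mulrC.
by rewrite ler_pM ?expR_ge0// addr_ge0 ?sqr_ge0.
Qed.

Lemma norm2E (R : realType) (d : measure_display) (M : measurableType d)
    (mu : {measure set M -> \bar R}) (f : M -> R) :
  norm2 mu f = (\int[mu]_xi (f xi ^+ 2)%:E)%E.
Proof.
have sqE (x : \bar R) : (0 <= x -> x ^+ 2 = poweR x 2)%E.
  case: x => [x| |]// x0.
    by rewrite poweR_EFin powR_mulrn// EFin_expe.
  by rewrite poweRyr.
rewrite /norm2 sqE ?Lnorm_ge0// poweR_Lnorm//; apply: eq_integral => xi _.
by rewrite /comp abse_EFin poweR_EFin powR_mulrn// real_normK// num_real.
Qed.

(** * Gevrey regularity of the solution by integration over the spectrum *)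

Section Solution.
Context (R : realType) (d : measure_display) (M : measurableType d).
Variables (mu : {measure set M -> \bar R}) (lambda : {mfun M >-> R}).

Definition gevrey_density (sigma rho alpha : R) (f : M -> R) (xi : M) : R :=
  (1 + lambda xi) `^ (4 * alpha) * f xi ^+ 2
    * expR (2 * rho * lambda xi `^ (2 * sigma)).

Lemma gevrey_density_ge0 sigma rho alpha f xi :
  0 <= gevrey_density sigma rho alpha f xi.
Proof. by rewrite mulr_ge0 ?expR_ge0// mulr_ge0 ?powR_ge0 ?sqr_ge0. Qed.

Lemma measurable_gevrey_density sigma rho alpha f :
  measurable_fun setT f -> measurable_fun setT (gevrey_density sigma rho alpha f).
Proof.
move=> mf; apply: measurable_funM; first apply: measurable_funM.
- apply: (@measurableT_comp _ _ _ _ _ _ (fun x => x `^ (4 * alpha))).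
    exact: measurable_powR.
  exact: measurable_funD.
- exact: measurable_funX.
- apply: (@measurableT_comp _ _ _ _ _ _ expR) => //.
  apply: measurable_funM => //.
  apply: (@measurableT_comp _ _ _ _ _ _ (fun x => x `^ (2 * sigma))) => //.
Qed.

Lemma gevrey_densityB sigma rho alpha (f g : M -> R) xi :
  gevrey_density sigma rho alpha (fun x => f x - g x) xi <=
  2 * (gevrey_density sigma rho alpha f xi + gevrey_density sigma rho alpha g xi).
Proof.
rewrite /gevrey_density; set a := _ `^ _; set e := expR _.
have -> : 2 * (a * f xi ^+ 2 * e + a * g xi ^+ 2 * e) =
  a * (2 * (f xi ^+ 2 + g xi ^+ 2)) * e by ring.
rewrite ler_wpM2r ?expR_ge0// ler_wpM2l ?powR_ge0//.
by have := sqr_ge0 (f xi + g xi); nra.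
Qed.

(** The weights do not depend on [s], so convergence of [g s xi] to 0 passes to the density, and [G]
    supplies the majorant. *)
Lemma gevrey_norm2_cvg0 sigma rho alpha (P : set R) (t e : R)
    (g : R -> M -> R) (G : M -> R) :
  0 < e -> (forall s, measurable_fun setT (g s)) ->
  mu.-integrable setT (EFin \o G) ->
  {ae mu, forall xi (s : R), P s -> `|s - t| < e ->
     gevrey_density sigma rho alpha (g s) xi <= G xi} ->
  {ae mu, forall xi, g s xi @[s --> within P (nbhs t)] --> 0} ->
  gevrey_norm2 mu lambda (fun x => x `^ (2 * sigma)) rho alpha (g s)
    @[s --> within P (nbhs t)] --> 0%E.
Proof.
move=> e0 mg iG gG g0.
apply: (@dominated_cvg_within _ _ _ _ P t e (fun s => gevrey_density sigma rho alpha (g s)) G) => //.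
- by move=> s; exact: measurable_gevrey_density.
- by move=> s xi; exact: gevrey_density_ge0.
- apply: filterS g0 => xi g0; rewrite /gevrey_density.
  rewrite -[X in _ --> X](mul0r (expR (2 * rho * lambda xi `^ (2 * sigma)))).
  apply: cvgM; last exact: cvg_cst.
  rewrite -[X in _ --> X](mulr0 ((1 + lambda xi) `^ (4 * alpha))).
  apply: cvgM; first exact: cvg_cst.
  by rewrite -(mul0r 0); apply: cvgM.
Qed.

Context (mu1 mu2 sigma delta r nu K : R) (c : R -> R) (f0 f1 : M -> R).
Variables (u v : R -> {mfun M >-> R}).
Hypotheses (m1 : 0 < mu1) (s0 : 0 < sigma) (d0 : 0 < delta) (r0 : 0 < r).
Hypotheses (nu1 : 1 <= nu) (K0 : 0 < K).
Hypothesis c_itv : forall t, 0 <= t -> mu1 <= c t <= mu2.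
Hypothesis decay :
  forall lam y v, nu <= lam -> oscillator delta sigma c lam y v ->
     forall t, 0 <= t -> v t ^+ 2 + (lam * y t) ^+ 2 <=
       K * (v 0 ^+ 2 + (lam * y 0) ^+ 2)
         * expR (- (2 * r * lam `^ (2 * sigma) * t)).
Hypothesis lam0 : forall xi, 0 <= lambda xi.
Hypothesis sol : is_solution mu lambda delta sigma c f0 f1 u v.

(** The majorant common to all times. Its weight is that of the Gevrey norm with [alpha = 1 / 2],
    and its integrability expresses that the data have finite energy and [f0] is square
    integrable. *)
Let data (xi : M) : R := f1 xi ^+ 2 + (1 + lambda xi) ^+ 2 * f0 xi ^+ 2.
Hypothesis data_int : mu.-integrable setT (EFin \o data).

Local Notation phi := (fun x : R => x `^ (2 * sigma)).
Local Notation density := (gevrey_density sigma).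

Let sol_oscillator : {ae mu, forall xi,
  [/\ u 0 xi = f0 xi, v 0 xi = f1 xi &
    oscillator delta sigma c (lambda xi) (u ^~ xi) (v ^~ xi)]}.
Proof. by apply: filterS sol => xi [-> -> uv [w vw ode]]; split=> //; split=> //; exists w. Qed.

(** The Gevrey exponent is frozen at [r * tau] while [t] ranges over [[tau, T]]. The null set is
    chosen before [t], so the bound may be used at a time that depends on [xi]. *)
Definition dominated_by_data alpha (h : R -> M -> R) :=
  forall tau T : R, 0 < tau -> exists2 C, 0 <= C &
    {ae mu, forall xi (t : R), tau <= t <= T ->
      density (r * tau) alpha (h t) xi <= C * data xi}.

Let density_half rho f xi : density rho (1 / 2) f xi =
  (1 + lambda xi) ^+ 2 * f xi ^+ 2 * expR (2 * rho * lambda xi `^ (2 * sigma)).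
Proof.
rewrite /gevrey_density (_ : 4 * (1 / 2) = 2%:R :> R); last by field.
by rewrite powR_mulrn// addr_ge0.
Qed.

Let density0 rho f xi : density rho 0 f xi =
  f xi ^+ 2 * expR (2 * rho * lambda xi `^ (2 * sigma)).
Proof. by rewrite /gevrey_density mulr0 powRr0 mul1r. Qed.

Let dominated_sol (tau T : R) : 0 < tau -> exists2 C, 0 <= C &
  {ae mu, forall xi (t : R), tau <= t <= T ->
     density (r * tau) (1 / 2) (u t) xi + density (r * tau) 0 (v t) xi
       <= C * data xi}.
Proof.
move=> tau0.
have [C C0 CP] := oscillator_gevrey_bound T m1 s0 d0 r0 nu1 K0 c_itv decay (ltW tau0).
exists C => //; apply: filterS sol_oscillator => xi [u0 v0 osc] t tT.
have := CP _ _ _ (lam0 xi) osc t tT; rewrite u0 v0 /data; apply: le_trans.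
by rewrite density_half density0 [leRHS]mulrDl addrC.
Qed.

Let dominated_half : dominated_by_data (1 / 2) u.
Proof.
move=> tau T /(@dominated_sol tau T)[C C0 CP]; exists C => //.
apply: filterS CP => xi H t /H; apply: le_trans.
by rewrite lerDl gevrey_density_ge0.
Qed.

Let dominated_velocity : dominated_by_data 0 v.
Proof.
move=> tau T /(@dominated_sol tau T)[C C0 CP]; exists C => //.
apply: filterS CP => xi H t /H; apply: le_trans.
by rewrite lerDr gevrey_density_ge0.
Qed.

Let dominated0 : dominated_by_data 0 u.
Proof.
move=> tau T /(@dominated_half tau T)[C C0 CP]; exists C => //.
apply: filterS CP => xi H t /H; apply: le_trans.
rewrite density_half density0 ler_wpM2r ?expR_ge0//.
by rewrite ler_peMl ?sqr_ge0// exprn_ege1// lerDl.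
Qed.

Let dataZ_int C : mu.-integrable setT (EFin \o (fun xi => C * data xi)).
Proof.
rewrite (_ : EFin \o _ = (fun xi => C%:E * (data xi)%:E)%E); last first.
  by apply/funext => xi /=; rewrite EFinM.
by apply: integrableZl => //.
Qed.

(** The majorant gives membership in the space, and dominated convergence upgrades continuity of the
    components to continuity in the norm. *)
Let gevrey_C0_of_dominated alpha (h : R -> {mfun M >-> R}) :
  dominated_by_data alpha h ->
  {ae mu, forall xi (t : R), 0 <= t ->
     h s xi @[s --> within `[0, +oo[ (nbhs t)] --> h t xi} ->
  gevrey_C0 mu lambda phi r alpha h.
Proof.
move=> hdom hcont tau tau0.
have gev t : tau <= t -> gevrey mu lambda phi (r * tau) alpha (h t).
  move=> taut; have [C C0 CP] := hdom tau t tau0.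
  have /integrableP[mC] := dataZ_int C; apply: le_lt_trans.
  apply: ae_ge0_le_integral => //.
  - by move=> xi _; rewrite lee_fin gevrey_density_ge0.
  - by apply/measurable_EFinP; exact: measurable_gevrey_density.
  - exact: measurableT_comp.
  apply: filterS CP => xi H _; rewrite /= lee_fin.
  by apply: le_trans (ler_norm _); apply: H; rewrite taut lexx.
split=> t /=; rewrite in_itv/= andbT => taut; first exact: gev.
(* The horizon [t + 1] covers every [s] within distance 1 of [t]; below, [4 * C] is twice the sum of
   the bounds at [s] and at [t]. *)
have [C C0 CP] := hdom tau (t + 1) tau0.
apply: (@gevrey_norm2_cvg0 sigma (r * tau) alpha _ t 1
  (fun s xi => h s xi - h t xi) (fun xi => 4 * C * data xi)) => //.
- by move=> s; exact: measurable_funB.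
- apply: filterS CP => xi H s /=; rewrite in_itv/= andbT => taus st.
  apply: le_trans (gevrey_densityB _ _ _ _ _ _) _.
  have sT : tau <= s <= t + 1.
    by rewrite taus -lerBlDl (le_trans (ler_norm _))// ltW.
  have tT : tau <= t <= t + 1 by rewrite taut lerDl ler01.
  by have := H s sT; have := H t tT; lra.
- apply: filterS hcont => xi hc; rewrite -(subrr (h t xi)).
  apply: cvgB; last exact: cvg_cst.
  apply: cvg_trans (hc t (le_trans (ltW tau0) taut)).
  apply: cvg_app; apply: within_subset => s /=.
  by rewrite !in_itv/= !andbT; exact: le_trans (ltW tau0).
Qed.

Let sol_cont : {ae mu, forall xi (t : R), 0 <= t ->
  u s xi @[s --> within `[0, +oo[ (nbhs t)] --> u t xi}.
Proof.
apply: filterS sol_oscillator => xi [_ _ [uv _]] t t0.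
by apply: derivative_on_cvg uv _; rewrite /= in_itv/= t0.
Qed.

Let velocity_cont : {ae mu, forall xi (t : R), 0 <= t ->
  v s xi @[s --> within `[0, +oo[ (nbhs t)] --> v t xi}.
Proof.
apply: filterS sol_oscillator => xi [_ _ [_ [w vw _]]] t t0.
by apply: (derivative_on_cvg vw); rewrite /= in_itv/= t0.
Qed.

Lemma solution_gevrey_C0 : gevrey_C0 mu lambda phi r (1 / 2) u.
Proof. exact: gevrey_C0_of_dominated. Qed.

Lemma solution_gevrey_C1 : gevrey_C1 mu lambda phi r 0 u v.
Proof.
move=> tau tau0; split; [exact: gevrey_C0_of_dominated..|].
move=> t /=; rewrite in_itv/= andbT => taut.
have [C C0 CP] := @dominated_velocity tau (t + 1) tau0.
(* Written as a restriction of [nbhs t], the punctured filter falls under the same convergence lemma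
   as continuity. *)
rewrite within_dnbhs.
apply: (@gevrey_norm2_cvg0 sigma (r * tau) 0 _ t 1
  (fun s xi => (s - t)^-1 * (u s xi - u t xi) - v t xi)
  (fun xi => 4 * C * data xi)) => //.
- move=> s; apply: measurable_funB => //; apply: measurable_funM => //.
  exact: measurable_funB.
- apply: filterS2 CP sol_oscillator => xi H [_ _ osc] s /= [].
  rewrite in_itv/= andbT => taus st ste.
  have s0' := le_trans (ltW tau0) taus; have t0 := le_trans (ltW tau0) taut.
  (* The intermediate time [a] depends on [xi] but lies between [s] and [t], hence in
     [[tau, t + 1]], where the bound on [v] applies. *)
  have [a /andP[a1 a2] vaE] := oscillator_slope osc s0' t0 st.
  apply: le_trans (gevrey_densityB _ _ _
    (fun x => (s - t)^-1 * (u s x - u t x)) _ _) _.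
  have sT : s <= t + 1.
    by rewrite -lerBlDl (le_trans (ler_norm _))// ltW.
  have aT : tau <= a <= t + 1.
    rewrite (le_trans _ a1) ?le_min ?taus//= (le_trans a2)// ge_max sT lerDl.
    exact: ler01.
  have tT : tau <= t <= t + 1 by rewrite taut lerDl ler01.
  have -> : density (r * tau) 0 (fun x => (s - t)^-1 * (u s x - u t x)) xi
      = density (r * tau) 0 (v a) xi by rewrite /gevrey_density vaE.
  by have := H a aT; have := H t tT; lra.
- apply: filterS sol => xi [_ _ uv _]; rewrite -(subrr (v t xi)) -within_dnbhs.
  apply: cvgB; last exact: cvg_cst.
  have t0 : (`[0, +oo[%classic : set R) t.
    by rewrite /= in_itv/= (le_trans (ltW tau0)).
  apply: cvg_trans (uv t t0).
  apply: cvg_app; apply: within_subset => s /=.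
  by rewrite !in_itv/= !andbT; exact: le_trans (ltW tau0).
Qed.

(** * The quantitative estimate on high frequencies *)

Hypotheses (mf0 : measurable_fun setT f0) (mf1 : measurable_fun setT f1).

Let measurable_high_freq f : measurable_fun setT f ->
  measurable_fun setT (high_freq lambda nu f).
Proof.
move=> mf; apply: measurable_fun_ifT => //.
exact: measurable_fun_ler.
Qed.

(** With exponent [r * t] the Gevrey weight cancels the decay factor exactly, so the estimate holds
    for almost every [xi] and integrates. The factor 4 again pays for replacing [1 + lambda xi] by
    [lambda xi]. *)
Lemma solution_high_freq_decay (t : R) : 0 <= t ->
  (gevrey_norm2 mu lambda phi (r * t) 0 (high_freq lambda nu (v t))
   + gevrey_norm2 mu lambda phi (r * t) (1 / 2) (high_freq lambda nu (u t))
  <= (4 * K)%:E * (norm2 mu (high_freq lambda nu f1)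
       + norm2 mu (frac_pow lambda (1 / 2) (high_freq lambda nu f0))))%E.
Proof.
move=> t0; have mhf := measurable_high_freq.
have K4 : 0 <= 4 * K by rewrite mulr_ge0// ltW.
have sq_ge0 (f : M -> R) xi : (0%R <= (f xi ^+ 2)%:E)%E by rewrite lee_fin sqr_ge0.
have msq (f : M -> R) : measurable_fun setT f ->
    measurable_fun setT (fun xi => (f xi ^+ 2)%:E).
  by move=> mf; apply/measurable_EFinP; exact: measurable_funX.
have mfrac : measurable_fun setT (frac_pow lambda (1 / 2) (high_freq lambda nu f0)).
  apply: measurable_funM; last exact: mhf.
  by apply: (@measurableT_comp _ _ _ _ _ _ (fun x => x `^ (2 * (1 / 2)))).
have mv := measurable_gevrey_density sigma (r * t) 0 (mhf _ (measurable_funPT (v t))).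
have mu' := measurable_gevrey_density sigma (r * t) (1 / 2) (mhf _ (measurable_funPT (u t))).
rewrite !norm2E -[leLHS]ge0_integralD//; last 4 first.
- by move=> xi _; rewrite lee_fin gevrey_density_ge0.
- exact/measurable_EFinP.
- by move=> xi _; rewrite lee_fin gevrey_density_ge0.
- exact/measurable_EFinP.
rewrite -ge0_integralD//; [|exact: (msq _ (mhf _ mf1))|exact: msq].
rewrite -ge0_integralZl//; last 2 first.
- by apply: emeasurable_funD; apply: msq => //; exact: mhf.
- by move=> xi _; apply: adde_ge0.
apply: ae_ge0_le_integral => //.
- by move=> xi _; rewrite -EFinD lee_fin addr_ge0// gevrey_density_ge0.
- by apply: emeasurable_funD; exact/measurable_EFinP.
- by move=> xi _; apply: mule_ge0; [rewrite lee_fin|apply: adde_ge0].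
- apply: measurable_funeM.
  by apply: emeasurable_funD; apply: msq => //; exact: mhf.
apply: filterS sol_oscillator => xi [u0 v0 osc] _.
rewrite -!EFinD -EFinM lee_fin.
rewrite -/(gevrey_density _ _ _ _ _) -/(density _ _ _ _) density0 density_half.
rewrite /frac_pow /high_freq (_ : 2 * (1 / 2) = 1 :> R); last by field.
(* Below [nu] the truncation makes both sides 0. *)
rewrite powRr1//; case: ifPn => nl; last first.
  by rewrite !(mulr0, expr0n, mul0r, addr0)/= ?(mulr0, mul0r, addr0).
rewrite -u0 -v0 -mulrDl -ler_pdivlMr ?expR_gt0// -expRN.
have l1 : 1 <= lambda xi by exact: le_trans nl.
apply: (@le_trans _ _ (4 * (v t xi ^+ 2 + (lambda xi * u t xi) ^+ 2))).
  have : (1 + lambda xi) ^+ 2 * u t xi ^+ 2 <= 4 * (lambda xi * u t xi) ^+ 2.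
    have -> : 4 * (lambda xi * u t xi) ^+ 2 = (2 * lambda xi) ^+ 2 * u t xi ^+ 2 by ring.
    rewrite ler_wpM2r ?sqr_ge0// ler_pXn2r// ?nnegrE; lra.
  by have := sqr_ge0 (v t xi); lra.
rewrite -[X in _ <= X * _]mulrA -[leRHS]mulrA ler_wpM2l//.
apply: le_trans (decay nl osc t0) _.
rewrite le_eqVlt; apply/orP; left; apply/eqP; congr (_ * expR _); ring.
Qed.

End Solution.

(** Quantifying [r], [nu] and [K] before the space, the operator, the coefficient and the data
    encodes that they depend only on [omega], [mu1], [mu2], [sigma] and [delta]. *)
Theorem theorem3p9 (R : realType) (omega : R -> R)
    (mu1 mu2 sigma delta : R) :
  continuity_modulus omega ->
  0 < mu1 ->
  0 < sigma -> sigma <= 1 / 2 ->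
  0 < delta ->
  (let Lambda := limf_esup
       (fun eps : R => (omega eps / eps `^ (1 - 2 * sigma))%:E) 0^'+ in
   Lambda ^+ 2 + (2 * delta)%:E * Lambda < (4 * delta ^+ 2 * mu1)%:E)%E ->
  let phi := fun x : R => x `^ (2 * sigma) in
  exists r nu K : R, [/\ 0 < r, 1 <= nu, 0 < K &
    forall (H : completeNormedModType R) (dot : {dot H for idfun})
      (domA : set H) (A : H -> H)
      (d : measure_display) (M : measurableType d)
      (mu : {measure set M -> \bar R}) (lambda : {mfun M >-> R})
      (hat : H -> LspaceType2 mu)
      (c : R -> R) (u0 u1 : H) (u v : R -> {mfun M >-> R}),
    hilbert_norm dot ->
    separable H ->
    selfadjoint_nonneg dot domA A ->
    spectral_representation domA A lambda hat ->
    (forall t, 0 <= t -> mu1 <= c t <= mu2) ->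
    (forall a b, 0 <= a -> 0 <= b -> `|c a - c b| <= omega `|a - b|) ->
    frac_dom mu lambda (1 / 2) (hat u0) ->
    is_solution mu lambda delta sigma c (hat u0) (hat u1) u v ->
    [/\ gevrey_C0 mu lambda phi r (1 / 2) u,
        gevrey_C1 mu lambda phi r 0 u v &
        forall t, 0 < t ->
          (gevrey_norm2 mu lambda phi (r * t) 0 (high_freq lambda nu (v t))
           + gevrey_norm2 mu lambda phi (r * t) (1 / 2)
               (high_freq lambda nu (u t))
           <= K%:E *
              (norm2 mu (high_freq lambda nu (hat u1))
               + norm2 mu (frac_pow lambda (1 / 2)
                             (high_freq lambda nu (hat u0)))))%E]].
Proof.
move=> om m1 s0 s12 d0 Lam phi.
have [r [nu [K [r0 nu1 K0 decay]]]] := high_frequency_decay mu2 om m1 s0 s12 d0 Lam.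
exists r, nu, (4 * K); split => //; first by rewrite mulr_gt0.
move=> H dot domA A d M mu lambda hat c u0 u1 u v _ _ _ spec c_itv c_mod.
move=> u0dom sol.
have lam0 := spec_lambda_ge0 spec.
have mu0 : measurable_fun setT (hat u0) by exact: measurable_funPT.
have mu1' : measurable_fun setT (hat u1) by exact: measurable_funPT.
(* Through the isometry, [u1] being a vector of [H] becomes square integrability. *)
have u1_int : (\int[mu]_xi (hat u1 xi ^+ 2)%:E < +oo)%E.
  by rewrite -norm2E /norm2 (spec_isometry spec) -EFin_expe ltry.
have int_sq (a f : M -> R) : measurable_fun setT a -> measurable_fun setT f ->
    (forall xi, 0 <= a xi) ->
    (\int[mu]_xi (a xi * f xi ^+ 2)%:E < +oo)%E ->
    mu.-integrable setT (fun xi => (a xi * f xi ^+ 2)%:E).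
  move=> ma mf a0 fin; apply/integrableP; split.
    by apply/measurable_EFinP/measurable_funM => //; exact: measurable_funX.
  apply: le_lt_trans fin; rewrite le_eqVlt; apply/orP; left; apply/eqP.
  by apply: eq_integral => xi _; rewrite gee0_abs// lee_fin mulr_ge0 ?sqr_ge0.
have data_int : mu.-integrable setT
    (EFin \o (fun xi => hat u1 xi ^+ 2 + (1 + lambda xi) ^+ 2 * hat u0 xi ^+ 2)).
  apply: (@integrableD _ _ _ _ _ measurableT (fun xi => (hat u1 xi ^+ 2)%:E)
    (fun xi => ((1 + lambda xi) ^+ 2 * hat u0 xi ^+ 2)%:E)).
  - have mul1 xi : cst 1 xi * hat u1 xi ^+ 2 = hat u1 xi ^+ 2 by rewrite mul1r.
    rewrite -(funext (fun xi => congr1 EFin (mul1 xi))); apply: int_sq => //.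
    by under eq_integral do rewrite mul1.
  - apply: int_sq => //; first exact/measurable_funX/measurable_funD.
      by move=> xi; exact: sqr_ge0.
    (* At [alpha = 1 / 2] the weight of [frac_dom] has exponent 2, as in the majorant. *)
    apply: le_lt_trans u0dom; rewrite le_eqVlt; apply/orP; left; apply/eqP.
    apply: eq_integral => xi _; rewrite (_ : 4 * (1 / 2) = 2%:R :> R); last by field.
    by rewrite powR_mulrn// addr_ge0.
have {}decay lam y v : nu <= lam -> oscillator delta sigma c lam y v -> _ :=
  decay c lam y v c_itv c_mod.
split.
- exact: (solution_gevrey_C0 m1 s0 d0 r0 nu1 K0 c_itv decay lam0 sol data_int).
- exact: (solution_gevrey_C1 m1 s0 d0 r0 nu1 K0 c_itv decay lam0 sol data_int).
- move=> t t0; exact: (solution_high_freq_decay nu1 K0 decay lam0 sol mu0 mu1' (ltW t0)).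
Qed.
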